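(* For every positive integer $N>1$, \[ \mathfrak{C}_2(N) = K(2N)^5 + O(N^4\log N), \qquad \text{where } K = \frac{10\zeta(2)}{3\zeta(3)}, \] and the implied constant is absolute.
   Context: For positive integers $d,N$, let $\mathrm{Mat}_d(\mathbb{Z},N)$ denote the set of $d\times d$ matrices with all entries in $[-N,N]\cap\mathbb{Z}$, and let $\mathfrak{C}_d(N)$ be the number of pairs $(A,B)\in \mathrm{Mat}_d(\mathbb{Z},N)^2$ with $AB=BA$. Here $\zeta$ is the Riemann zeta function. *)

(* Defs.v *)
From HB Require Import structures.
From mathcomp Require Import all_boot all_order all_algebra.
From Stdlib Require Import Reals.
From Coquelicot Require Import Coquelicot.

Set Implicit Arguments. Unset Strict Implicit. Unset Printing Implicit Defensive.
Import GRing.Theory.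

(* Entry encoding: i : 'I_(2N+1) represents the integer i - N, a bijection
   onto [-N, N] ∩ Z. *)
Definition ent (N : nat) (i : 'I_(2 * N + 1)) : int := GRing.add (Posz i) (GRing.opp (Posz N)).

Definition mat_of (d N : nat) (A : 'M['I_(2 * N + 1)]_d) : 'M[int]_d :=
  map_mx (@ent N) A.

Definition Cfrak (d N : nat) : nat :=
  #|[set p : 'M['I_(2 * N + 1)]_d * 'M['I_(2 * N + 1)]_d |
      mulmx (mat_of p.1) (mat_of p.2) == mulmx (mat_of p.2) (mat_of p.1)]|.

Definition zeta (s : nat) : R := Series (fun k => / (INR (k + 1)) ^ s).

Definition Kconst : R := (10 * zeta 2 / (3 * zeta 3))%R.

(* Main.v *)
(** Matrices [a b; c d] and [e f; g h] commute iff the vectors u = (b, c, a - d)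
    and v = (f, g, e - h) are parallel. When both are nonzero there are unique
    coprime k, l >= 1 and a unique sign with l u = +-k v, and then u = k q and
    v = +-l q for an integer vector q. Write n = 2N + 1. The pairs with u = 0 or
    v = 0 number 2 n^5 - n^2. For m = max(k, l) and j = min(k, l) the remaining
    pairs of ratio (k, l) number
      (2 floor(N/m) + 1)^2 * sum_t (n - m|t|)^+ (n - j|t|)^+ - n^2
        = n^5/m^3 (1 - j/(3m)) + O(n^4/m^2).
    Summing over coprime pairs with m <= 2N, where the coprime j < m average to
    m/2, the main terms add up to (10/3) n^5 sum_m phi(m)/m^3 and the errors to
    O(n^4 sum_m 1/m) = O(N^4 log N). Finally sum_m phi(m)/m^3 = zeta(2)/zeta(3)
    because the divisors of m have totients summing to m. *)

From mathcomp Require all_boot all_order all_algebra zify ring cyclic.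
From HB Require structures.
From Stdlib Require Import Lra.
From Coquelicot Require Import Coquelicot.
Require Import Defs.
From Stdlib Require Import Reals.

Module Combinatorics.

Import all_boot all_order all_algebra zify ring.
Import Order.TTheory GRing.Theory Num.Theory.
Set Implicit Arguments. Unset Strict Implicit. Unset Printing Implicit Defensive.
Local Open Scope ring_scope.

(** * Solutions of [l a = k b] with [k] and [l] coprime, counted through fibers *)

Definition fiber (A : finType) (alpha : A -> int) (z : int) : nat :=
  \sum_(x : A) (alpha x == z).

(** Coprimality gives [k %| a] by Gauss, and the quotient [t] then determines [b] up to the common
    sign. Since [k >= 1], the bound on [a] also bounds [t]. The equality of indicators, rather than
    an equivalence, is what gets summed over all pairs. *)
Lemma proportional_coprimeE (k l M : nat) (a b : int) :
  (0 < k)%N -> (0 < l)%N -> coprime k l -> (`|a| <= M)%N ->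
  (l%:Z * a == k%:Z * b)%R =
  ((a == 0) && (b == 0) +
   \sum_(1 <= t < M.+1) ((a == (k * t)%N%:Z) && (b == (l * t)%N%:Z) +
                         (a == - (k * t)%N%:Z)%R && (b == - (l * t)%N%:Z)%R))%N :> nat.
Proof.
move=> k0 l0 cop leM.
have [E|nE] := eqVneq (l%:Z * a)%R (k%:Z * b)%R; last first.
  have nEP x y : l%:Z * x = k%:Z * y -> (a == x) && (b == y) = false.
    by move=> H; apply/negP => /andP[/eqP ax /eqP byy]; case/eqP: nE; rewrite ax byy.
  rewrite nEP ?mulr0 // big1_seq // => t _; rewrite !nEP //; lia.
have kda : (k %| `|a|)%N.
  have : (k %| l * `|a|)%N by apply/dvdnP; exists `|b|%N; nia.
  by rewrite Gauss_dvdr.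
case/dvdnP: kda => t Et.
have Eb : (`|b| = l * t)%N.
  have : (l * `|a| = k * `|b|)%N by nia.
  rewrite Et => H; apply/eqP; rewrite -(eqn_pmul2l k0); apply/eqP; nia.
have [t0|t0] := posnP t.
  rewrite big1_seq => [|i /=].
    by have [-> ->] : a = 0 /\ b = 0 by subst t; rewrite ?mul0n ?muln0 in Et Eb; lia.
  rewrite mem_index_iota => /andP[i0 _].
  have -> : (a == (k * i)%N%:Z) = false by apply/eqP; nia.
  by have -> : (a == - (k * i)%N%:Z)%R = false by apply/eqP; nia.
have tM : (t < M.+1)%N by nia.
rewrite (bigD1_seq t) /= ?mem_index_iota ?iota_uniq ?t0 //.
rewrite big1 => [|i it]; last first.
  have -> : (a == (k * i)%N%:Z) = false.
    by apply/eqP => H; case/eqP: it; apply/eqP; rewrite -(eqn_pmul2l k0); lia.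
  by have -> : (a == - (k * i)%N%:Z)%R = false
    by apply/eqP => H; case/eqP: it; apply/eqP; rewrite -(eqn_pmul2l k0); lia.
have a0 : a != 0%R by apply/eqP; nia.
rewrite (negbTE a0) /= addn0.
have [ap|an] := lerP 0 a.
  have -> : a = (k * t)%N%:Z by lia.
  have -> : b = (l * t)%N%:Z by nia.
  by rewrite !eqxx /=; case: eqP => //=; nia.
have -> : a = (- (k * t)%N%:Z)%R by lia.
have -> : b = (- (l * t)%N%:Z)%R by nia.
by rewrite !eqxx /= addnC; case: eqP => //=; nia.
Qed.

(** Summing [proportional_coprimeE] over all pairs, each joint indicator factors into a product of
    two fibers, and symmetry merges the solutions for [t] and [-t] into the factor 2. A separate
    [beta] leaves room for a sign change of [alpha]. *)
Lemma card_proportional (A : finType) (alpha beta : A -> int) (k l M : nat) :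
  (0 < k)%N -> (0 < l)%N -> coprime k l -> (forall x, `|alpha x| <= M)%N ->
  (forall z, fiber alpha (- z)%R = fiber alpha z) ->
  (forall z, fiber beta z = fiber alpha z) ->
  (#|[set p : A * A | l%:Z * alpha p.1 == k%:Z * beta p.2]%R| =
   fiber alpha 0 ^ 2 +
   2 * \sum_(1 <= t < M.+1) fiber alpha (k * t)%N * fiber alpha (l * t)%N)%N.
Proof.
move=> k0 l0 cop bd sym ab.
have prodE z w : (\sum_(x : A) \sum_(y : A) ((alpha x == z) && (beta y == w)) =
    fiber alpha z * fiber alpha w)%N.
  rewrite -[fiber alpha w]ab /fiber big_distrl /=; apply: eq_bigr => x _.
  by rewrite big_distrr /=; apply: eq_bigr => y _; rewrite mulnb.
rewrite -sum1_card big_mkcond /=.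
under eq_bigr => p _ do rewrite inE -[if _ then _ else _]/(nat_of_bool _)
  (@proportional_coprimeE k l M) //.
rewrite -(pair_bigA _ (fun x y =>
  (((alpha x == 0%R) && (beta y == 0)) +
   \sum_(1 <= t < M.+1) ((alpha x == (k * t)%N%:Z) && (beta y == (l * t)%N%:Z) +
      (alpha x == - (k * t)%N%:Z)%R && (beta y == - (l * t)%N%:Z)%R))%N)) /=.
under eq_bigr => x _ do rewrite big_split /=.
rewrite big_split /= prodE; congr addn.
under eq_bigr => x _ do rewrite exchange_big /=.
rewrite exchange_big /= big_distrr /=; apply: eq_bigr => t _.
under eq_bigr => x _ do rewrite big_split /=.
by rewrite big_split /= !prodE !sym; lia.
Qed.

(** * Fibers of matrix entries and of differences of diagonal entries *)

Definition ord_diff (n : nat) (p : 'I_n * 'I_n) : int := (p.1%:Z - p.2%:Z)%R.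

Lemma fiber_ent (N : nat) (z : int) : fiber (@ent N) z = (`|z| <= N)%N.
Proof.
rewrite /fiber; have [zN|zN] := leqP `|z| N; last first.
  rewrite big1 // => x _; rewrite /ent; case: eqP => //= E.
  by have := ltn_ord x; lia.
have lt : (`|(z + N%:Z)%R| < 2 * N + 1)%N by lia.
rewrite (bigD1 (Ordinal lt)) //= big1 => [|i ii].
  by rewrite /ent /=; case: eqP => //=; lia.
rewrite /ent; case: eqP => // E; case/eqP: ii; apply: val_inj => /=; lia.
Qed.

(** Swapping the two indices reduces to [z = t >= 0], where the pairs are [(j + t, j)] with
    [j + t < n]. Truncated subtraction gives the correct value 0 once [t >= n]. *)
Lemma fiber_ord_diff (n : nat) (z : int) : fiber (@ord_diff n) z = (n - `|z|)%N.
Proof.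
wlog z0 : z / (0 <= z)%R => [H|].
  have [|zn] := lerP 0 z; first exact: H.
  rewrite -(_ : `|(- z)%R|%N = `|z|%N) -?H; [|lia|lia].
  rewrite /fiber (reindex_inj (h := fun p : 'I_n * 'I_n => (p.2, p.1))) /=; last first.
    by move=> [a b] [c d] /= [-> ->].
  by apply: eq_bigr => p _; rewrite /ord_diff /=; congr nat_of_bool; lia.
have [t ->] : exists t : nat, z = t by exists `|z|%N; lia.
rewrite /fiber -(pair_bigA _ (fun x y : 'I_n => nat_of_bool (ord_diff (x, y) == t%:Z))) /=.
rewrite exchange_big /=.
transitivity (\sum_(j < n) (j + t < n))%N.
  apply: eq_bigr => j _; have [lt|ge] := ltnP (j + t)%N n.
    rewrite (bigD1 (Ordinal lt)) //= big1 => [|i ii].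
      by rewrite /ord_diff /=; case: eqP => //=; lia.
    rewrite /ord_diff; case: eqP => //= E; case/eqP: ii; apply: val_inj => /=; lia.
  rewrite big1 // => i _; rewrite /ord_diff /=; case: eqP => //= E.
  by have := ltn_ord i; lia.
rewrite -(big_mkord xpredT (fun j => nat_of_bool (j + t < n)%N)) /=.
rewrite (big_cat_nat (n := (n - t)%N)) //=; last by lia.
rewrite (eq_big_nat _ _ (F2 := fun=> 1%N)); last by move=> i ?; have -> : (i + t < n)%N by lia.
rewrite [X in (_ + X)%N]big_nat [X in (_ + X)%N]big1 => [|i ?]; last first.
  by have -> : (i + t < n)%N = false by lia.
by rewrite sum_nat_const_nat /=; lia.
Qed.

Lemma sum_leq_mul (m N M : nat) : (0 < m)%N ->
  (\sum_(1 <= t < M.+1) (m * t <= N) = minn M (N %/ m))%N.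
Proof.
move=> m0; elim: M => [|M IH]; first by rewrite big_geq // min0n.
rewrite big_nat_recr //= IH mulnC -leq_divRL //; lia.
Qed.

(** * Reduced signed ratios of two integers: existence, uniqueness, cross products *)

Definition signed (s : bool) (z : int) : int := if s then - z else z.

Lemma fiber_signed (A : finType) (alpha : A -> int) (s : bool) (z : int) :
  (forall z, fiber alpha (- z) = fiber alpha z) ->
  fiber (signed s \o alpha) z = fiber alpha z.
Proof.
move=> sym; case: s; rewrite /fiber //= -[RHS]sym /fiber.
by apply: eq_bigr => x _; rewrite eqr_oppLR.
Qed.

(** Cross-multiplied form of [a : b = k : l] up to the sign [s]; the pair [(0, 0)] satisfies it for
    every ratio. *)
Definition proportional (k l : nat) (s : bool) (a b : int) : bool :=
  l%:Z * a == k%:Z * signed s b.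

Lemma proportional_exists (M : nat) (a b : int) :
  a != 0 -> b != 0 -> (`|a| <= M)%N -> (`|b| <= M)%N ->
  exists k l s, [/\ (0 < k <= M)%N, (0 < l <= M)%N, coprime k l & proportional k l s a b].
Proof.
move=> a0 b0 aM bM.
have g0 : (0 < gcdn `|a| `|b|)%N by rewrite gcdn_gt0; lia.
set g := gcdn _ _ in g0.
have [k Ek] := dvdnP (dvdn_gcdl `|a| `|b|); have [l El] := dvdnP (dvdn_gcdr `|a| `|b|).
rewrite -/g in Ek El.
(* [k] and [l] are the absolute values divided by their gcd, and the sign records whether [a] and
   [b] have opposite signs. *)
exists k, l, ((0 < a) != (0 < b)); split; try nia.
  by rewrite /coprime -(eqn_pmul2r g0) muln_gcdl -Ek -El mul1n.
have H : (l * `|a| = k * `|b|)%N by rewrite Ek El; lia.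
rewrite /proportional /signed; apply/eqP; case: ifP; nia.
Qed.

Lemma proportional_unique (k l k' l' : nat) (s s' : bool) (a b : int) :
  a != 0 -> (0 < k)%N -> (0 < l)%N -> (0 < k')%N -> (0 < l')%N ->
  coprime k l -> coprime k' l' -> proportional k l s a b -> proportional k' l' s' a b ->
  [/\ k = k', l = l' & s = s'].
Proof.
move=> a0 k0 l0 k0' l0' c c' /eqP E /eqP E'.
have es : s = s' by move: E E'; rewrite /signed; case: s; case: s' => //=; nia.
subst s'.
have H : (l * `|a| = k * `|b|)%N by move: E; rewrite /signed; case: s {E'}; nia.
have H' : (l' * `|a| = k' * `|b|)%N by move: E'; rewrite /signed; case: s {E}; nia.
have a0' : (0 < `|a|)%N by lia.
(* Eliminating [a] and [b] leaves equality of two reduced fractions; coprimality then makes [k] and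
   [k'] divide each other. *)
have X : (l * k' = l' * k)%N.
  apply/eqP; rewrite -(eqn_pmul2r a0'); apply/eqP.
  by rewrite mulnAC H [RHS]mulnAC H'; lia.
have kk : (k %| k')%N by rewrite -(Gauss_dvdr _ c) X dvdn_mull.
have kk' : (k' %| k)%N by rewrite -(Gauss_dvdr _ c') -X dvdn_mull.
have ek : k = k' by apply/eqP; rewrite eqn_dvd kk.
by split=> //; subst k'; apply/eqP; rewrite -(eqn_pmul2r k0); apply/eqP.
Qed.

Lemma proportional_cross (k l : nat) (s : bool) (a b a' b' : int) :
  (0 < l)%N -> proportional k l s a b -> proportional k l s a' b' -> a * b' = a' * b.
Proof.
move=> l0 /eqP E /eqP E'.
have l0' : l%:Z != 0 by lia.
apply: (mulfI l0'); rewrite !mulrA E E' /signed; case: s {E E'}; ring.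
Qed.

(** Converse of [proportional_cross] when [a] is nonzero: one nonzero coordinate fixes the ratio,
    and vanishing cross products carry it to the other coordinates. *)
Lemma proportional_transfer (k l : nat) (s : bool) (a b a' b' : int) :
  a != 0 -> proportional k l s a b -> a * b' = a' * b -> proportional k l s a' b'.
Proof.
move=> a0 /eqP E C; apply/eqP; apply: (mulfI a0).
rewrite mulrCA [a * _]mulrC mulrCA E.
have -> : a' * (k%:Z * signed s b) = k%:Z * signed s (a' * b) by rewrite /signed; case: s {E}; ring.
by rewrite -C /signed; case: s {E}; ring.
Qed.

(** * Commuting pairs of 2 by 2 matrices as pairs of parallel integer vectors *)

Section Count.
Variable N : nat.
Local Notation n := (2 * N + 1)%N.
Local Notation I := 'I_n.
Local Notation M := (2 * N)%N.
(** The grouping keeps matching coordinates of the two vectors together, so that the count for a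
    fixed ratio is a product of three independent counts. *)
Local Notation Q := (((I * I) * (I * I)) * ((I * I) * (I * I)))%type.

Definition matrix2 (a b c d : I) : 'M[I]_2 :=
  \matrix_(i, j) if i == 0 then (if j == 0 then a else b) else (if j == 0 then c else d).

(* q = (((b, f), (c, g)), ((a, d), (e, h))) encodes the pair of matrices
   A = [a b; c d] and B = [e f; g h]. *)
Definition matrix_pair (q : Q) : 'M[I]_2 * 'M[I]_2 :=
  (matrix2 q.2.1.1 q.1.1.1 q.1.2.1 q.2.1.2, matrix2 q.2.2.1 q.1.1.2 q.1.2.2 q.2.2.2).

Lemma matrix_pair_bij : bijective matrix_pair.
Proof.
exists (fun p : 'M[I]_2 * 'M[I]_2 =>
  (((p.1 0 1, p.2 0 1), (p.1 1 0, p.2 1 0)), ((p.1 0 0, p.1 1 1), (p.2 0 0, p.2 1 1)))).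
  by move=> [[[b f] [c g]] [[a d] [e h]]]; rewrite /matrix_pair /= !mxE.
have ord2 (i : 'I_2) : i = 0 \/ i = 1.
  by case: i => [[|[|//]] ?]; [left|right]; apply: val_inj.
by move=> [A B]; congr pair; apply/matrixP => i j; rewrite mxE;
  case: (ord2 i) (ord2 j) => -> [] ->.
Qed.

Definition comm (q : Q) : bool :=
  let: (((b, f), (c, g)), (ad, eh)) := q in
  [&& ent b * ent g == ent c * ent f, ent b * ord_diff eh == ord_diff ad * ent f
    & ent c * ord_diff eh == ord_diff ad * ent g].

Lemma ent_ord_diff (a b : I) : ent a - ent b = ord_diff (a, b).
Proof. by rewrite /ent /ord_diff /=; ring. Qed.

(** The diagonal entries of [AB - BA] are [bg - cf] and its negative; the off-diagonal entries are,
    up to sign, the two other minors of the vectors [(b, c, a - d)] and [(f, g, e - h)]. *)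
Lemma comm_matrix_pair (q : Q) :
  (mulmx (mat_of (matrix_pair q).1) (mat_of (matrix_pair q).2) ==
   mulmx (mat_of (matrix_pair q).2) (mat_of (matrix_pair q).1)) = comm q.
Proof.
case: q => [[[b f] [c g]] [[a d] [e h]]]; rewrite /comm /= -!ent_ord_diff.
apply/eqP/and3P => [H|[/eqP H1 /eqP H2 /eqP H3]].
  have H00 := congr1 (fun X : 'M[int]_2 => X 0 0) H.
  have H01 := congr1 (fun X : 'M[int]_2 => X 0 1) H.
  have H10 := congr1 (fun X : 'M[int]_2 => X 1 0) H.
  move: H00 H01 H10; rewrite !mxE !big_ord_recl !big_ord0 /= !mxE /=.
  move: (ent a) (ent b) (ent c) (ent d) (ent e) (ent f) (ent g) (ent h).
  move=> {H} a' b' c' d' e' f' g' h' H1 H2 H3.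
  by split; apply/eqP; lia.
have ord2 (i : 'I_2) : i = 0 \/ i = 1.
  by case: i => [[|[|//]] ?]; [left|right]; apply: val_inj.
apply/matrixP => i j; case: (ord2 i) (ord2 j) => -> [] ->;
  rewrite !mxE !big_ord_recl !big_ord0 /= !mxE /=;
  move: (ent a) (ent b) (ent c) (ent d) (ent e) (ent f) (ent g) (ent h) H1 H2 H3;
  move=> *; lia.
Qed.

Lemma Cfrak_comm : Cfrak 2 N = (\sum_(q : Q) comm q)%N.
Proof.
rewrite /Cfrak -sum1_card big_mkcond /= (reindex matrix_pair) /=;
  last exact/onW_bij/matrix_pair_bij.
by apply: eq_bigr => q _; rewrite inE comm_matrix_pair; case: comm.
Qed.

(** The vector [(b, c, a - d)] vanishes exactly when the first matrix is scalar. *)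
Definition scal1 (q : Q) : bool :=
  [&& ent q.1.1.1 == 0, ent q.1.2.1 == 0 & ord_diff q.2.1 == 0].
Definition scal2 (q : Q) : bool :=
  [&& ent q.1.1.2 == 0, ent q.1.2.2 == 0 & ord_diff q.2.2 == 0].
Definition ratio (k l : nat) (s : bool) (q : Q) : bool :=
  [&& proportional k l s (ent q.1.1.1) (ent q.1.1.2), proportional k l s (ent q.1.2.1) (ent q.1.2.2)
    & proportional k l s (ord_diff q.2.1) (ord_diff q.2.2)].

Lemma ratio_comm (k l : nat) (s : bool) (q : Q) : (0 < l)%N -> ratio k l s q -> comm q.
Proof.
case: q => [[[b f] [c g]] [ad eh]] l0 /and3P[/= p1 p2 p3]; rewrite /comm.
by apply/and3P; split; apply/eqP; apply: proportional_cross; eassumption.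
Qed.

Lemma proportional_eq0 (k l : nat) (s : bool) (a b : int) :
  (0 < k)%N -> (0 < l)%N -> proportional k l s a b -> (a == 0) = (b == 0).
Proof.
move=> k0 l0 /eqP; rewrite /signed => E; apply/eqP/eqP => H; move: E; rewrite H; case: s; nia.
Qed.

(** With [k] and [l] positive, proportional vectors vanish together. Hence excluding [scal1] from a
    ratio class also excludes [scal2]. *)
Lemma ratio_scal (k l : nat) (s : bool) (q : Q) :
  (0 < k)%N -> (0 < l)%N -> ratio k l s q -> scal1 q = scal2 q.
Proof.
move=> k0 l0 /and3P[p1 p2 p3].
rewrite /scal1 /scal2 (proportional_eq0 k0 l0 p1).
by rewrite (proportional_eq0 k0 l0 p2) (proportional_eq0 k0 l0 p3).
Qed.

Lemma ratio_unique (k l k' l' : nat) (s s' : bool) (q : Q) :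
  ~~ scal1 q -> (0 < k)%N -> (0 < l)%N -> (0 < k')%N -> (0 < l')%N ->
  coprime k l -> coprime k' l' -> ratio k l s q -> ratio k' l' s' q ->
  [/\ k = k', l = l' & s = s'].
Proof.
move=> sc k0 l0 k0' l0' c c' /and3P[p1 p2 p3] /and3P[p1' p2' p3'].
by move: sc; rewrite /scal1 !negb_and => /or3P[] nz; apply: (proportional_unique nz); eassumption.
Qed.

Lemma ent_le (x : I) : (`|ent x| <= M)%N.
Proof. by rewrite /ent; have := ltn_ord x; lia. Qed.

Lemma ord_diff_le (p : I * I) : (`|ord_diff p| <= M)%N.
Proof. by rewrite /ord_diff; have := ltn_ord p.1; have := ltn_ord p.2; lia. Qed.

Lemma cross_eq0 (a b a' b' : int) : a != 0 -> b = 0 -> a * b' = a' * b -> b' = 0.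
Proof. by move=> a0 -> /eqP; rewrite mulr0 mulf_eq0 (negbTE a0) => /eqP. Qed.

(** Choose a nonzero coordinate of the first vector. The matching coordinate of the second is
    nonzero too, since otherwise the vanishing minors would make the whole second vector zero. The
    reduced ratio of these two coordinates transfers to the others. The bound [2 * N] is needed for
    differences of diagonal entries. *)
Lemma comm_ratio (q : Q) : ~~ scal1 q -> ~~ scal2 q -> comm q ->
  exists k l s, [/\ (0 < k <= M)%N, (0 < l <= M)%N, coprime k l & ratio k l s q].
Proof.
case: q => [[[b f] [c g]] [ad eh]]; rewrite /scal1 /scal2 /comm /ratio /=.
move=> s1 s2 /and3P[/eqP h1 /eqP h2 /eqP h3].
move: s1; rewrite !negb_and => /or3P[] nz.
- have nz' : ent f != 0.
    apply/eqP => H; move: s2; rewrite H (cross_eq0 nz H h1) (cross_eq0 nz H h2).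
    by rewrite !eqxx.
  have [k [l [s [kb lb cop p]]]] := proportional_exists nz nz' (ent_le b) (ent_le f).
  exists k, l, s; split => //; apply/and3P; split => //; exact: (proportional_transfer nz p).
- have nz' : ent g != 0.
    apply/eqP => H; move: s2; rewrite H (cross_eq0 nz H (esym h1)) (cross_eq0 nz H h3).
    by rewrite !eqxx.
  have [k [l [s [kb lb cop p]]]] := proportional_exists nz nz' (ent_le c) (ent_le g).
  exists k, l, s; split => //; apply/and3P; split => //;
    by apply: (proportional_transfer nz p); rewrite ?h1 ?h3.
- have nz' : ord_diff eh != 0.
    apply/eqP => H; move: s2; rewrite H (cross_eq0 nz H (esym h2)) (cross_eq0 nz H (esym h3)).
    by rewrite !eqxx.
  have [k [l [s [kb lb cop p]]]] := proportional_exists nz nz' (ord_diff_le ad) (ord_diff_le eh).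
  exists k, l, s; split => //; apply/and3P; split => //;
    by apply: (proportional_transfer nz p); rewrite ?h2 ?h3.
Qed.

Local Notation K := ('I_M * 'I_M * bool)%type.

(** A commuting pair either contains a scalar matrix or has exactly one reduced signed ratio.
    Successors of elements of ['I_M] make [k] and [l] run over [1, ..., 2 * N]. *)
Lemma comm_sum (q : Q) :
  comm q = ((scal1 q || scal2 q) + \sum_(x : K | coprime x.1.1.+1 x.1.2.+1)
     (~~ scal1 q && ratio x.1.1.+1 x.1.2.+1 x.2 q))%N :> nat.
Proof.
have [s1|s1] := boolP (scal1 q).
  rewrite big1 //=; case: q s1 => [[[b f] [c g]] [ad eh]] /and3P[/= /eqP h1 /eqP h2 /eqP h3].
  by rewrite /comm h1 h2 h3 !mul0r !eqxx.
have [s2|s2] := boolP (scal2 q) => /=.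
  rewrite big1 => [|x _].
    case: q s1 s2 => [[[b f] [c g]] [ad eh]] _ /and3P[/= /eqP h1 /eqP h2 /eqP h3].
    by rewrite /comm h1 h2 h3 !mulr0 !eqxx.
  case: (boolP (ratio _ _ _ _)) => // /ratio_scal; rewrite s2 => H.
  by rewrite H in s1.
rewrite add0n; have [cq|ncq] := boolP (comm q); last first.
  rewrite big1 // => x _; case: (boolP (ratio _ _ _ _)) => // /ratio_comm H.
  by rewrite H in ncq.
have [[|k] [[|l] [s [// kb // lb cop r]]]] := comm_ratio s1 s2 cq.
rewrite (bigD1 ((Ordinal (kb : (k < M)%N), Ordinal (lb : (l < M)%N)), s)) //= r big1 //.
move=> [[i j] s'] /= /andP[c' ne]; case: (boolP (ratio _ _ _ _)) => // r'.
have [//|//|//|//|e1 e2 e3] := ratio_unique s1 _ _ _ _ cop c' r r'.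
by case/eqP: ne; congr ((_, _), _); rewrite ?e3 //; apply: val_inj => /=; lia.
Qed.

(** * Exact counts for scalar pairs and for each fixed ratio *)

Lemma sum_Q (F1 F2 : pred (I * I)) (F3 : pred ((I * I) * (I * I))) :
  (\sum_(q : Q) [&& F1 q.1.1, F2 q.1.2 & F3 q.2] =
   (\sum_p F1 p) * (\sum_p F2 p) * \sum_p F3 p)%N.
Proof.
rewrite -(pair_bigA _ (fun x y => nat_of_bool [&& F1 x.1, F2 x.2 & F3 y])) /=.
rewrite -(pair_bigA _ (fun x y => (\sum_z [&& F1 x, F2 y & F3 z])%N)) /=.
rewrite -mulnA [RHS]big_distrl /=; apply: eq_bigr => x _.
rewrite [X in _ = (_ * X)%N]big_distrl [RHS]big_distrr /=; apply: eq_bigr => y _.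
rewrite mulnA big_distrr /=; apply: eq_bigr => z _.
by rewrite -!mulnb mulnA.
Qed.

Lemma fiber_ent_sym (z : int) : fiber (@ent N) (- z) = fiber (@ent N) z.
Proof. by rewrite !fiber_ent abszN. Qed.

Lemma fiber_ord_diff_sym (z : int) : fiber (@ord_diff n) (- z) = fiber (@ord_diff n) z.
Proof. by rewrite !fiber_ord_diff abszN. Qed.

Lemma sum_proportional_ent (k l : nat) (s : bool) : (0 < k)%N -> (0 < l)%N -> coprime k l ->
  (\sum_(p : I * I) proportional k l s (ent p.1) (ent p.2) = 1 + 2 * (N %/ maxn k l))%N.
Proof.
move=> k0 l0 cop.
have := card_proportional k0 l0 cop ent_le fiber_ent_sym
  (fun z => @fiber_signed _ (@ent N) s z fiber_ent_sym).
rewrite -sum1_card big_mkcond /= => H.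
transitivity (\sum_(p : I * I)
  if p \in [set p : I * I | l%:Z * ent p.1 == k%:Z * signed s (ent p.2)]%R then 1 else 0)%N.
  by apply: eq_bigr => p _; rewrite inE /proportional; case: (_ == _).
rewrite H fiber_ent /=; congr (_ + 2 * _)%N.
(* Both [k t] and [l t] are admissible entries exactly when [maxn k l * t <= N]. *)
rewrite (eq_bigr (fun t => nat_of_bool (maxn k l * t <= N)%N)) => [|t _].
  rewrite sum_leq_mul; last by lia.
  by apply/minn_idPr; rewrite (leq_trans (leq_div _ _)) //; lia.
by rewrite !fiber_ent mulnb !absz_nat maxnMl geq_max.
Qed.

Lemma sum_proportional_ord_diff (k l : nat) (s : bool) : (0 < k)%N -> (0 < l)%N -> coprime k l ->
  (\sum_(p : (I * I) * (I * I)) proportional k l s (ord_diff p.1) (ord_diff p.2) =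
   n ^ 2 + 2 * \sum_(1 <= t < n) (n - k * t) * (n - l * t))%N.
Proof.
move=> k0 l0 cop.
have := card_proportional k0 l0 cop ord_diff_le fiber_ord_diff_sym
  (fun z => @fiber_signed _ (@ord_diff n) s z fiber_ord_diff_sym).
rewrite -sum1_card big_mkcond /= => H.
transitivity (\sum_(p : (I * I) * (I * I))
  if p \in [set p : (I * I) * (I * I) | l%:Z * ord_diff p.1 == k%:Z * signed s (ord_diff p.2)]%R
  then 1 else 0)%N.
  by apply: eq_bigr => p _; rewrite inE /proportional; case: (_ == _).
rewrite H -[M.+1]addn1 fiber_ord_diff /= subn0; congr (_ + 2 * _)%N.
by apply: eq_bigr => t _; rewrite !fiber_ord_diff !absz_nat.
Qed.

Lemma sum_pair_and (A B : finType) (F : pred A) (G : pred B) :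
  (\sum_(p : A * B) (F p.1 && G p.2) = (\sum_x F x) * \sum_y G y)%N.
Proof.
rewrite -(pair_bigA _ (fun x y => nat_of_bool (F x && G y))) /= big_distrl /=.
apply: eq_bigr => x _; rewrite big_distrr /=; apply: eq_bigr => y _.
by rewrite mulnb.
Qed.

Lemma sum_predT (A : finType) : (\sum_(x : A) (predT x) = #|A|)%N.
Proof. by rewrite /= sum1_card. Qed.

Lemma sum_ent0 : (\sum_(x : I) (ent x == 0) = 1)%N.
Proof. by rewrite -/(fiber _ _) fiber_ent. Qed.

Lemma sum_ord_diff0 : (\sum_(x : I * I) (ord_diff x == 0) = n)%N.
Proof. by rewrite -/(fiber _ _) fiber_ord_diff subn0. Qed.

(** There are [n] scalar matrices, and the second matrix is one of [n ^ 4] arbitrary ones. *)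
Lemma sum_scal1 : (\sum_(q : Q) scal1 q = n ^ 5)%N.
Proof.
rewrite (sum_Q (fun p => ent p.1 == 0) (fun p => ent p.1 == 0) (fun p => ord_diff p.1 == 0)).
under eq_bigr do rewrite -[X in nat_of_bool X]andbT.
rewrite (sum_pair_and (fun x : I => ent x == 0) predT) sum_predT sum_ent0 mul1n.
under [X in (_ * X)%N]eq_bigr do rewrite -[X in nat_of_bool X]andbT.
rewrite (sum_pair_and (fun x : I * I => ord_diff x == 0) predT) sum_predT sum_ord_diff0.
by rewrite card_prod card_ord; lia.
Qed.

Lemma sum_scal2 : (\sum_(q : Q) scal2 q = n ^ 5)%N.
Proof.
rewrite (sum_Q (fun p => ent p.2 == 0) (fun p => ent p.2 == 0) (fun p => ord_diff p.2 == 0)).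
rewrite (sum_pair_and predT (fun x : I => ent x == 0)) sum_predT sum_ent0 muln1.
rewrite (sum_pair_and predT (fun x : I * I => ord_diff x == 0)) sum_predT sum_ord_diff0.
by rewrite card_prod card_ord; lia.
Qed.

Lemma sum_scal12 : (\sum_(q : Q) (scal1 q && scal2 q) = n ^ 2)%N.
Proof.
pose F (p : I * I) := (ent p.1 == 0) && (ent p.2 == 0).
transitivity (\sum_(q : Q) [&& F q.1.1, F q.1.2 & (ord_diff q.2.1 == 0) && (ord_diff q.2.2 == 0)])%N.
  apply: eq_bigr => q _; congr nat_of_bool; rewrite /scal1 /scal2 /F.
  by do 6![case: (_ == 0)].
rewrite (sum_Q F F (fun p => (ord_diff p.1 == 0) && (ord_diff p.2 == 0))).
rewrite (sum_pair_and (fun x : I => ent x == 0) (fun x : I => ent x == 0)) sum_ent0.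
rewrite (sum_pair_and (fun x : I * I => ord_diff x == 0) (fun x : I * I => ord_diff x == 0)) sum_ord_diff0.
lia.
Qed.

(** The product on the right counts every pair of ratio [(k, l)]: the squared factor for the two
    off-diagonal coordinates, the last one for the diagonals. It includes the [n ^ 2] pairs of
    scalar matrices, which are added back on the left to avoid truncated subtraction. *)
Lemma sum_nonscal_ratio (k l : nat) (s : bool) : (0 < k)%N -> (0 < l)%N -> coprime k l ->
  (\sum_(q : Q) (~~ scal1 q && ratio k l s q) + n ^ 2 =
   (1 + 2 * (N %/ maxn k l)) ^ 2 *
   (n ^ 2 + 2 * \sum_(1 <= t < n) (n - k * t) * (n - l * t)))%N.
Proof.
move=> k0 l0 cop.
rewrite -(sum_proportional_ord_diff s k0 l0 cop) -(sum_proportional_ent s k0 l0 cop) -sum_scal12 -big_split /=.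
rewrite expnS expn1 -(sum_Q (fun p => proportional k l s (ent p.1) (ent p.2))
  (fun p => proportional k l s (ent p.1) (ent p.2)) (fun p => proportional k l s (ord_diff p.1) (ord_diff p.2))).
apply: eq_bigr => q _; rewrite -/(ratio k l s q).
have [r|nr] := boolP (ratio k l s q).
  by rewrite -(ratio_scal k0 l0 r); case: (scal1 q).
rewrite andbF; case: (boolP (scal1 q)) => // s1; case: (boolP (scal2 q)) => // s2.
case/negP: nr; move: s1 s2 => /and3P[/eqP h1 /eqP h2 /eqP h3] /and3P[/eqP e1 /eqP e2 /eqP e3].
by rewrite /ratio /proportional h1 h2 h3 e1 e2 e3 /signed; case: s; rewrite ?oppr0 !mulr0.
Qed.

(** Terms to be subtracted stand on the left so that the identity holds in [nat]. The single [n ^ 2]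
    is the overlap of the two scalar cases, and the factor 2 before the double sums is the choice of
    sign. *)
Lemma Cfrak2E :
  (Cfrak 2 N + n ^ 2 + 2 * \sum_(1 <= k < n) \sum_(1 <= l < n | coprime k l) n ^ 2 =
   2 * n ^ 5 + 2 * \sum_(1 <= k < n) \sum_(1 <= l < n | coprime k l)
   (1 + 2 * (N %/ maxn k l)) ^ 2 *
   (n ^ 2 + 2 * \sum_(1 <= t < n) (n - k * t) * (n - l * t)))%N.
Proof.
have tr (F : nat -> nat -> nat) : (\sum_(1 <= k < n) \sum_(1 <= l < n | coprime k l) F k l =
    \sum_(x : 'I_M * 'I_M | coprime x.1.+1 x.2.+1) F x.1.+1 x.2.+1)%N.
  rewrite addn1 big_add1 /= big_mkord.
  under [LHS]eq_bigr do rewrite big_add1 /= big_mkord.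
  by rewrite (pair_big_dep xpredT (fun i j : 'I_M => coprime i.+1 j.+1)
    (fun i j : 'I_M => F i.+1 j.+1)).
have tr2 (F : nat -> nat -> nat) :
    (2 * \sum_(1 <= k < n) \sum_(1 <= l < n | coprime k l) F k l =
    \sum_(x : K | coprime x.1.1.+1 x.1.2.+1) F x.1.1.+1 x.1.2.+1)%N.
  rewrite tr big_distrr /=.
  transitivity (\sum_(x : 'I_M * 'I_M | coprime x.1.+1 x.2.+1)
    \sum_(b : bool) F x.1.+1 x.2.+1)%N.
    by apply: eq_bigr => x _; rewrite sum_nat_const card_bool.
  by rewrite pair_big; apply: eq_bigl => x; rewrite andbT.
rewrite !tr2 Cfrak_comm.
under eq_bigr do rewrite comm_sum.
rewrite big_split /= exchange_big /=.
have <- : (\sum_(q : Q) (scal1 q || scal2 q) + n ^ 2 = 2 * n ^ 5)%N.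
  have -> : (2 * n ^ 5 = \sum_(q : Q) scal1 q + \sum_(q : Q) scal2 q)%N.
    by rewrite sum_scal1 sum_scal2 addnn mul2n.
  rewrite -sum_scal12 -!big_split /=.
  by apply: eq_bigr => q _; case: (scal1 q); case: (scal2 q).
rewrite -[LHS]addnA addnACA; congr addn; rewrite -big_split /=.
by apply: eq_bigr => x cop; rewrite sum_nonscal_ratio.
Qed.

End Count.

End Combinatorics.

Module Analysis.

Import HB.structures all_boot zify cyclic Combinatorics.
Set Implicit Arguments. Unset Strict Implicit. Unset Printing Implicit Defensive.
Local Open Scope R_scope.

(** * Finite sums of real numbers *)

Lemma Rplus_associative : associative Rplus.
Proof. by move=> x y z; rewrite Rplus_assoc. Qed.

HB.instance Definition _ :=
  Monoid.isComLaw.Build R 0 Rplus Rplus_associative Rplus_comm Rplus_0_l.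
HB.instance Definition _ := Monoid.isMulLaw.Build R 0 Rmult Rmult_0_l Rmult_0_r.
HB.instance Definition _ :=
  Monoid.isAddLaw.Build R Rmult Rplus Rmult_plus_distr_r Rmult_plus_distr_l.

Local Notation "\sum_ ( m <= i < n ) F" := (\big[Rplus/0]_(m <= i < n) F) : R_scope.
Local Notation "\sum_ ( m <= i < n | P ) F" := (\big[Rplus/0]_(m <= i < n | P%B) F) : R_scope.

Lemma INR_sum (I : Type) (r : seq I) (P : pred I) (F : I -> nat) :
  INR (\sum_(i <- r | P i) F i)%N = \big[Rplus/0]_(i <- r | P i) INR (F i).
Proof. by apply: (big_morph INR) => // x y; rewrite plus_INR. Qed.

Lemma Rsum_le (I : eqType) (r : seq I) (P : pred I) (F G : I -> R) :
  (forall i, i \in r -> P i -> F i <= G i) ->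
  \big[Rplus/0]_(i <- r | P i) F i <= \big[Rplus/0]_(i <- r | P i) G i.
Proof.
move=> le; rewrite big_seq_cond [X in _ <= X]big_seq_cond.
apply: (big_ind2 Rle) => [|x y z t|i /andP[]]; [lra|lra|exact: le].
Qed.

Lemma Rsum_ge0 (I : eqType) (r : seq I) (P : pred I) (F : I -> R) :
  (forall i, i \in r -> P i -> 0 <= F i) -> 0 <= \big[Rplus/0]_(i <- r | P i) F i.
Proof.
by move=> le; rewrite big_seq_cond; elim/big_ind: _ => [|x y|i /andP[]]; [lra|lra|exact: le].
Qed.

Lemma Rsum_abs (I : Type) (r : seq I) (P : pred I) (F : I -> R) :
  Rabs (\big[Rplus/0]_(i <- r | P i) F i) <= \big[Rplus/0]_(i <- r | P i) Rabs (F i).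
Proof.
elim/big_ind2: _ => [|x y z t|i _]; [rewrite Rabs_R0; lra| |lra].
by move=> ? ?; apply: Rle_trans (Rabs_triang _ _) _; lra.
Qed.

Lemma Rsum_opp (I : Type) (r : seq I) (P : pred I) (F : I -> R) :
  \big[Rplus/0]_(i <- r | P i) (- F i) = - \big[Rplus/0]_(i <- r | P i) F i.
Proof. by elim/big_ind2: _ => [|x y z t -> ->|//]; lra. Qed.

Lemma Rsum_sub (I : Type) (r : seq I) (P : pred I) (F G : I -> R) :
  \big[Rplus/0]_(i <- r | P i) (F i - G i) =
  \big[Rplus/0]_(i <- r | P i) F i - \big[Rplus/0]_(i <- r | P i) G i.
Proof. by rewrite /Rminus big_split /= Rsum_opp. Qed.

Lemma Rsum_const_nat (L : nat) (c : R) : \sum_(1 <= t < L.+1) c = INR L * c.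
Proof.
elim: L => [|L IH]; first by rewrite big_geq //=; lra.
by rewrite big_nat_recr //= IH; case: L {IH} => [|L] /=; lra.
Qed.

(** * Asymptotic count for one ratio *)

Lemma sum_quadratic (x a b : R) (L : nat) :
  \sum_(1 <= t < L.+1) ((x - a * INR t) * (x - b * INR t)) =
  x ^ 2 * INR L - x * (a + b) * (INR L * (INR L + 1) / 2)
  + a * b * (INR L * (INR L + 1) * (2 * INR L + 1) / 6).
Proof.
elim: L => [|L IH]; first by rewrite big_geq //=; lra.
rewrite big_nat_recr //= IH -/(INR L.+1) !S_INR; field.
Qed.

(** The sum is cut where its terms vanish and evaluated in closed form. Relative to [m ^ 2], the
    main term is cubic in [n / m], and the remainder turns out to be only linear in [n / m], hence
    at most [2 * (n / m) ^ 2]. *)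
Lemma lattice_sum_estimate (n m j : nat) :
  (0 < j)%N -> (j <= m)%N -> (m < n)%N ->
  Rabs (INR (n ^ 2 + 2 * \sum_(1 <= t < n) (n - m * t) * (n - j * t))%N
        - INR n ^ 3 / INR m * (1 - INR j / (3 * INR m))) <= 2 * INR n ^ 2.
Proof.
(* [L] is the largest [t] with [m t < n]. Using [n.-1] keeps [L < n] even for [m = 1], so the cut
   lies inside the summation range; the omitted terms are 0. *)
move=> j0 jm mn; set L := (n.-1 %/ m)%N.
have m0 : (0 < m)%N by lia.
have Ln : (L < n)%N by have := leq_div n.-1 m; rewrite -/L; lia.
have mL : (m * L < n)%N by have := leq_divM n.-1 m; rewrite -/L mulnC; lia.
have mL1 : (n <= m * L.+1)%N by have := @ltn_ceil n.-1 m m0; rewrite -/L mulnC; lia.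
have -> : (\sum_(1 <= t < n) (n - m * t) * (n - j * t) =
           \sum_(1 <= t < L.+1) (n - m * t) * (n - j * t))%N.
  rewrite (big_cat_nat (n := L.+1)) //= [X in (_ + X)%N]big_nat [X in (_ + X)%N]big1 ?addn0 //.
  move=> t /andP[Lt _]; have -> : (n - m * t = 0)%N by nia.
  by [].
rewrite plus_INR (mult_INR 2) INR_sum.
rewrite (eq_big_nat _ _ (F2 := fun t =>
  (INR n - INR m * INR t) * (INR n - INR j * INR t))); last first.
  move=> t /andP[t0 tL]; rewrite mult_INR !minus_INR ?mult_INR //; apply/leP; nia.
rewrite sum_quadratic.
have -> : INR (n ^ 2)%N = INR n ^ 2 by rewrite -mulnn mult_INR /=; lra.
have {mL} mL : INR m * INR L <= INR n by rewrite -mult_INR; apply/le_INR/leP; lia.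
have {mL1} mL1 : INR n <= INR m * (INR L + 1).
  by rewrite -S_INR -mult_INR; apply/le_INR/leP; lia.
have {}m0 : 1 <= INR m by apply: (le_INR 1); apply/leP.
have {}j0 : 0 <= INR j by exact: pos_INR.
have {}jm : INR j <= INR m by apply/le_INR/leP.
have {}mn : INR m <= INR n by apply/le_INR/leP; lia.
have -> : INR 2 = 2 by [].
have L0 := pos_INR L.
move: (INR n) (INR m) (INR j) (INR L) mL mL1 m0 j0 jm mn L0 {Ln}; clearbody L => {}n {}m {}j {}L.
move=> mL mL1 m0 j0 jm mn L0.
(* Rescaling by [m]: the rounding error [th] and the slope [la] both lie in [[0, 1]], and
   [x >= 1]. *)
pose x := n / m; pose th := x - L; pose la := j / m.
have En : n = m * x by rewrite /x; field; lra.
have Ej : j = m * la by rewrite /la; field; lra.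
have EL : L = x - th by rewrite /th; lra.
have la0 : 0 <= la by rewrite Ej in j0; nra.
have la1 : la <= 1 by rewrite Ej in jm; nra.
have th0 : 0 <= th by rewrite En in mL; rewrite /th; nra.
have th1 : th <= 1 by rewrite En in mL1; rewrite /th; nra.
have x1 : 1 <= x by rewrite En in mn; nra.
clearbody x th la; subst.
(* Exact remainder: all terms in [x ^ 3] and [x ^ 2] cancel against the main term. *)
have -> : (m * x) ^ 2 +
   2 *
   ((m * x) ^ 2 * (x - th) - m * x * (m + m * la) * ((x - th) * (x - th + 1) / 2) +
    m * (m * la) * ((x - th) * (x - th + 1) * (2 * (x - th) + 1) / 6)) -
   (m * x) ^ 3 / m * (1 - m * la / (3 * m)) =
   m ^ 2 * (x * (th * (1 - th)) + la * (x * (th * (1 - th)) +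
     x * (6 * th ^ 2 - 6 * th + 1) / 3 + (- th + 3 * th ^ 2 - 2 * th ^ 3) / 3)).
  by field; lra.
have p0 : 0 <= th * (1 - th) by apply: Rmult_le_pos; lra.
have p1 : th * (1 - th) <= 1 / 4 by have := pow2_ge_0 (th - 1 / 2); lra.
clear j0 jm mn L0 mL mL1.
set p := th * (1 - th) in p0 p1 *.
have -> : 6 * th ^ 2 - 6 * th + 1 = 1 - 6 * p by rewrite /p; ring.
have -> : - th + 3 * th ^ 2 - 2 * th ^ 3 = p * (2 * th - 1) by rewrite /p; ring.
have q1 : Rabs (p * (2 * th - 1)) <= 1 / 4 by apply: Rabs_le; nra.
have q2 : Rabs (x * p + x * (1 - 6 * p) / 3 + p * (2 * th - 1) / 3) <= x.
  move: q1 => /Rabs_le_between q1; apply: Rabs_le; nra.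
have q3 : Rabs (la * (x * p + x * (1 - 6 * p) / 3 + p * (2 * th - 1) / 3)) <= x.
  rewrite Rabs_mult (Rabs_pos_eq la) //;
  have := Rabs_pos (x * p + x * (1 - 6 * p) / 3 + p * (2 * th - 1) / 3); nra.
rewrite Rabs_mult (Rabs_pos_eq (m ^ 2)); last by nra.
have q4 : Rabs (x * p + la * (x * p + x * (1 - 6 * p) / 3 + p * (2 * th - 1) / 3)) <= 2 * x ^ 2.
  move: q3 => /Rabs_le_between q3; apply: Rabs_le; nra.
have : 0 <= m ^ 2 by nra.
nra.
Qed.

Lemma ratio_count_estimate (N m j : nat) (n := (2 * N + 1)%N) :
  (0 < j)%N -> (j <= m)%N -> (m < n)%N ->
  Rabs (INR ((1 + 2 * (N %/ m)) ^ 2 *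
             (n ^ 2 + 2 * \sum_(1 <= t < n) (n - m * t) * (n - j * t)))%N - INR n ^ 2
        - INR n ^ 5 / INR m ^ 3 * (1 - INR j / (3 * INR m)))
  <= 21 * INR n ^ 4 / INR m ^ 2.
Proof.
move=> j0 jm mn; have est := lattice_sum_estimate j0 jm mn.
rewrite mult_INR; move: est; set T := INR (n ^ 2 + _)%N.
have m0 : (0 < m)%N by lia.
have mL : (m * (N %/ m) <= N)%N by have := leq_divM N m; rewrite mulnC; lia.
have mL1 : (N < m * (N %/ m).+1)%N by have := @ltn_ceil N m m0; rewrite mulnC; lia.
have -> : INR ((1 + 2 * (N %/ m)) ^ 2)%N = (1 + 2 * INR (N %/ m)) ^ 2.
  by rewrite -mulnn mult_INR (plus_INR 1) (mult_INR 2) /=; lra.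
have En : INR n = 2 * INR N + 1 by rewrite /n plus_INR (mult_INR 2) /=; lra.
have {}mL : INR m * INR (N %/ m) <= INR N by rewrite -mult_INR; apply/le_INR/leP; lia.
have {}mL1 : INR N + 1 <= INR m * (INR (N %/ m) + 1).
  by rewrite -!S_INR -mult_INR; apply/le_INR/leP; lia.
have {}m0 : 1 <= INR m by apply: (le_INR 1); apply/leP.
have {}j0 : 0 <= INR j by exact: pos_INR.
have {}jm : INR j <= INR m by apply/le_INR/leP.
have {}mn : INR m <= INR n by apply/le_INR/leP; lia.
have L0 := pos_INR (N %/ m).
have T0 : 0 <= T by exact: pos_INR.
move: (INR n) (INR N) (INR m) (INR j) (INR (N %/ m)) T En mL mL1 m0 j0 jm mn L0 T0.
move=> {}n {}N {}m {}j L T En mL mL1 m0 j0 jm mn L0 T0.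
pose x := n / m; pose la := j / m.
have Ex : n = m * x by rewrite /x; field; lra.
have Ej : j = m * la by rewrite /la; field; lra.
have la0 : 0 <= la by rewrite Ej in j0; nra.
have la1 : la <= 1 by rewrite Ej in jm; nra.
have x1 : 1 <= x by rewrite Ex in mn; nra.
have X1 : 1 + 2 * L <= x + 1 by nra.
have X2 : x - 2 <= 1 + 2 * L by nra.
have -> : n ^ 3 / m * (1 - j / (3 * m)) = n ^ 2 * (x * (1 - la / 3)).
  by rewrite /x Ej; field; lra.
have -> : n ^ 5 / m ^ 3 * (1 - j / (3 * m)) = x ^ 2 * (n ^ 2 * (x * (1 - la / 3))).
  by rewrite /x Ej; field; lra.
have -> : 21 * n ^ 4 / m ^ 2 = 21 * n ^ 2 * x ^ 2 by rewrite /x; field; lra.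
set T1 := n ^ 2 * _ => /Rabs_le_between HT.
have n2 : 0 <= n ^ 2 by nra.
have T1b : T1 <= n ^ 2 * x by apply: Rmult_le_compat_l => //; nra.
have Tb : T <= 3 * n ^ 2 * x by nra.
have XX : Rabs ((1 + 2 * L) ^ 2 - x ^ 2) <= 6 * x by apply: Rabs_le; nra.
(* The error splits into that of the squared factor, at most [18 * n ^ 2 * x ^ 2], and that of the
   lattice sum together with [n ^ 2], at most [3 * n ^ 2 * x ^ 2]; this gives the constant 21. *)
have -> : (1 + 2 * L) ^ 2 * T - n ^ 2 - x ^ 2 * T1 =
  ((1 + 2 * L) ^ 2 - x ^ 2) * T + (x ^ 2 * (T - T1) - n ^ 2) by ring.
apply: Rle_trans (Rabs_triang _ _) _.
rewrite Rabs_mult (Rabs_pos_eq T) //.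
have A1 : Rabs ((1 + 2 * L) ^ 2 - x ^ 2) * T <= 6 * x * (3 * n ^ 2 * x).
  by apply: Rmult_le_compat => //; exact: Rabs_pos.
have A2 : Rabs (x ^ 2 * (T - T1) - n ^ 2) <= 3 * n ^ 2 * x ^ 2.
  have x2 : 1 <= x ^ 2 by nra.
  by apply: Rabs_le; nra.
nra.
Qed.

(** * Sums over coprime pairs and totients *)

Lemma coprime_self (m : nat) : (1 < m)%N -> coprime m m = false.
Proof. by move=> m1; rewrite /coprime gcdnn; apply/eqP; lia. Qed.

Lemma sum_coprime1 (F : nat -> R) : \sum_(1 <= j < 2 | coprime 1 j) F j = F 1%N.
Proof. by rewrite big_mkcond big_nat1. Qed.

(** Pairs are sorted by their maximum. Each off-diagonal pair occurs in two orders, while [(1, 1)],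
    the only coprime diagonal pair, must be counted once. *)
Lemma sum_coprime_pairs_max (g : nat -> nat -> R) (n : nat) :
  (1 < n)%N -> (forall k l, g k l = g l k) ->
  \sum_(1 <= k < n) \sum_(1 <= l < n | coprime k l) g k l =
  2 * \sum_(1 <= m < n) \sum_(1 <= j < m.+1 | coprime m j) g m j - g 1%N 1%N.
Proof.
move=> n1 sym; elim: n n1 => // [[//|[|n]]] IH _.
  by rewrite !big_nat1 !sum_coprime1 /=; lra.
have {}IH := IH isT; set p := n.+2 in IH *.
have p1 : (1 < p)%N by [].
have rec k : \sum_(1 <= l < p.+1 | coprime k l) g k l =
    \sum_(1 <= l < p | coprime k l) g k l + (if coprime k p then g k p else 0).
  by rewrite big_mkcond big_nat_recr // -big_mkcond.
rewrite !(@big_nat_recr _ _ _ p) //= rec coprime_self //.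
rewrite (eq_bigr _ (fun k _ => rec k)) big_split /= IH.
rewrite -(big_mkcond (fun k => coprime k p)) /=.
have -> : \sum_(1 <= k < p | coprime k p) g k p = \sum_(1 <= k < p | coprime p k) g p k.
  by apply: eq_big => [k|k _]; rewrite ?(coprime_sym k) ?(sym k).
lra.
Qed.

Lemma sum_coprime_trunc (m : nat) (F : nat -> R) : (1 < m)%N ->
  \sum_(1 <= j < m.+1 | coprime m j) F j = \sum_(1 <= j < m | coprime m j) F j.
Proof.
move=> m1; rewrite big_mkcond big_nat_recr /=; last by lia.
by rewrite coprime_self // -big_mkcond Rplus_0_r.
Qed.

Lemma totient_sum (m : nat) : (1 < m)%N ->
  \sum_(1 <= j < m | coprime m j) 1 = INR (totient m).
Proof.
move=> m1; rewrite totient_count_coprime INR_sum big_ltn; last by lia.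
have -> : coprime m 0 = false by rewrite /coprime gcdn0; apply/eqP; lia.
rewrite Rplus_0_l big_mkcond; apply: eq_bigr => j _; by case: coprime.
Qed.

Lemma coprime_subr (m j : nat) : (j <= m)%N -> coprime m (m - j) = coprime m j.
Proof.
move=> jm; rewrite /coprime; congr (_ == _).
apply/eqP; rewrite eqn_dvd !dvdn_gcd !dvdn_gcdl /=.
rewrite (dvdn_sub (dvdn_gcdl m j) (dvdn_gcdr m j)) andbT.
by have := dvdn_sub (dvdn_gcdl m (m - j)) (dvdn_gcdr m (m - j)); rewrite subKn.
Qed.

(** The reflection of [j] to [m - j] preserves coprimality with [m], so the sum equals its own
    complement in [m * totient m]. *)
Lemma sum_coprime_id (m : nat) : (1 < m)%N ->
  \sum_(1 <= j < m | coprime m j) INR j = INR m * INR (totient m) / 2.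
Proof.
move=> m1; set S := (X in X = _).
suff : S = INR m * INR (totient m) - S by lra.
rewrite -totient_sum // big_distrr /= -Rsum_sub /S big_nat_rev /=.
rewrite big_nat_cond [RHS]big_nat_cond; apply: eq_big => [j|j /andP[/andP[j1 jm] _]].
  case: (boolP (1 <= j < m)%N) => //= /andP[j1 jm].
  by rewrite add1n subSS coprime_subr // ltnW.
by rewrite add1n subSS minus_INR; [lra|apply/leP; lia].
Qed.

(** Since [j] averages [m / 2], the mean weight is [1 - 1/6 = 5/6]. The case [m = 1] is exceptional:
    there [j = m] is coprime to [m], with weight [2/3 = 5/6 - 1/6]. *)
Lemma sum_coprime_weight (m : nat) : (0 < m)%N ->
  \sum_(1 <= j < m.+1 | coprime m j) (1 - INR j / (3 * INR m)) =
  5 / 6 * INR (totient m) - (if m == 1%N then 1 / 6 else 0).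
Proof.
move=> m0; case: (eqVneq m 1%N) => [->|m1].
  by rewrite sum_coprime1 /=; field.
have {}m1 : (1 < m)%N by lia.
have mR : 0 < INR m by apply/lt_0_INR/leP.
rewrite sum_coprime_trunc // Rsum_sub totient_sum //.
rewrite (eq_bigr (fun j => / (3 * INR m) * INR j)) => [|j _]; last by rewrite /Rdiv Rmult_comm.
by rewrite -big_distrr /= sum_coprime_id //; field; lra.
Qed.

(** * Bounds on partial sums and convergence of the series *)

Lemma sum_inv_sq (a b : nat) : (0 < a)%N -> (a <= b)%N ->
  \sum_(a.+1 <= m < b.+1) (/ INR m ^ 2) <= / INR a - / INR b.
Proof.
move=> a0; elim: b => [|b IH] ab; first by lia.
case: (eqVneq a b.+1) => [->|ne]; first by rewrite big_geq //; lra.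
have ab' : (a <= b)%N by lia.
rewrite big_nat_recr // S_INR; move: (IH ab') => /= {}IH.
have b0 : 1 <= INR b by apply: (le_INR 1); apply/leP; lia.
(* Telescoping comparison of the last term. *)
suff : / ((INR b + 1) * ((INR b + 1) * 1)) <= / INR b - / (INR b + 1) by lra.
have -> : / INR b - / (INR b + 1) = / (INR b * (INR b + 1)) by field; lra.
by apply: Rinv_le_contravar; nra.
Qed.

Lemma harmonic_le (n : nat) : (0 < n)%N -> \sum_(1 <= m < n.+1) (/ INR m) <= 1 + ln (INR n).
Proof.
elim: n => // [[|n]] IH _; first by rewrite big_nat1 /= ln_1; lra.
rewrite big_nat_recr //; have {}IH := IH isT.
have n0 : 1 <= INR n.+1 by apply: (le_INR 1); apply/leP; lia.
rewrite (S_INR n.+1); move: (INR n.+1) n0 IH => x x1 IH.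
suff : / (x + 1) <= ln (x + 1) - ln x by move: IH; rewrite /=; lra.
(* The inequality [ln y <= y - 1] at [y = x / (x + 1)] bounds [/ (x + 1)] by the increment of
   [ln]. *)
have : ln (x / (x + 1)) <= x / (x + 1) - 1.
  have p : 0 < x / (x + 1) by apply: Rdiv_lt_0_compat; lra.
  by have := exp_ineq1_le (ln (x / (x + 1))); rewrite exp_ln //; lra.
rewrite ln_div; [|lra|lra].
have -> : x / (x + 1) - 1 = - / (x + 1) by field; lra.
lra.
Qed.

Lemma sum_n_big (a : nat -> R) (n : nat) : sum_n a n = \sum_(0 <= i < n.+1) a i.
Proof.
elim: n => [|n IH]; first by rewrite sum_O big_nat1.
by rewrite sum_Sn IH [RHS]big_nat_recr.
Qed.

(** Monotone convergence. The shift [k + 1] matches the indexing of [zeta]. *)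
Lemma bounded_series (f : nat -> R) (B : R) :
  (forall m, (0 < m)%N -> 0 <= f m) ->
  (forall n, \sum_(1 <= m < n.+1) f m <= B) ->
  is_lim_seq (fun n => \sum_(1 <= m < n.+1) f m) (Series (fun k => f (k + 1)%N)).
Proof.
move=> f0 fB; set u := fun n => _.
have uE n : sum_n (fun k => f (k + 1)%N) n = u n.+1.
  by rewrite sum_n_big /u big_add1 /=; apply: eq_bigr => i _; rewrite addn1.
have inc n : u n <= u n.+1.
  by rewrite /u [X in _ <= X]big_nat_recr //=; have := f0 n.+1 isT; lra.
have [l ul] := ex_finite_lim_seq_incr u B inc fB.
have sl : is_series (fun k => f (k + 1)%N) l.
  change (is_lim_seq (sum_n (fun k => f (k + 1)%N)) l).
  apply: (is_lim_seq_ext (fun n => u n.+1)) => [n|]; first by rewrite uE.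
  exact/(is_lim_seq_incr_1 u).
by rewrite (is_series_unique _ _ sl).
Qed.

Lemma bounded_series_ge (f : nat -> R) (B : R) (n : nat) :
  (forall m, (0 < m)%N -> 0 <= f m) ->
  (forall n, \sum_(1 <= m < n.+1) f m <= B) ->
  \sum_(1 <= m < n.+1) f m <= Series (fun k => f (k + 1)%N).
Proof.
move=> f0 fB; have lim := bounded_series f0 fB.
apply: (is_lim_seq_incr_compare (fun n => \sum_(1 <= m < n.+1) f m)) => // p.
by rewrite [X in _ <= X]big_nat_recr //=; have := f0 p.+1 isT; lra.
Qed.

Lemma bounded_series_le (f : nat -> R) (B B' : R) (n : nat) :
  (forall m, (0 < m)%N -> 0 <= f m) ->
  (forall n, \sum_(1 <= m < n.+1) f m <= B) ->
  (forall p, (n <= p)%N -> \sum_(1 <= m < p.+1) f m <= B') ->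
  Series (fun k => f (k + 1)%N) <= B'.
Proof.
move=> f0 fB fB'; have lim := bounded_series f0 fB.
apply: (is_lim_seq_le_loc _ _ _ _ _ lim (is_lim_seq_const B')).
by exists n => p /leP; exact: fB'.
Qed.

Lemma totient_le (m : nat) : (totient m <= m)%N.
Proof.
rewrite totient_count_coprime -[X in (_ <= X)%N]subn0 -[X in (_ <= X)%N]muln1.
by rewrite -sum_nat_const_nat; apply: leq_sum => i _; case: coprime.
Qed.

Lemma INR_ge1 (m : nat) : (0 < m)%N -> 1 <= INR m.
Proof. by move=> m0; apply: (le_INR 1); apply/leP. Qed.

Lemma inv_pow_ge0 (s m : nat) : (0 < m)%N -> 0 <= / INR m ^ s.
Proof. by move=> /INR_ge1 m1; apply/Rlt_le/Rinv_0_lt_compat/pow_lt; lra. Qed.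

Lemma totient_cube_ge0 (m : nat) : (0 < m)%N -> 0 <= INR (totient m) * / INR m ^ 3.
Proof. by move=> m0; apply: Rmult_le_pos (inv_pow_ge0 _ m0); exact: pos_INR. Qed.

Lemma totient_cube_le (m : nat) : (0 < m)%N -> INR (totient m) * / INR m ^ 3 <= / INR m ^ 2.
Proof.
move=> m0; have m1 := INR_ge1 m0.
have -> : / INR m ^ 2 = INR m * / INR m ^ 3 by field; lra.
by apply: Rmult_le_compat_r (inv_pow_ge0 _ m0) _; apply/le_INR/leP/totient_le.
Qed.

Lemma sum_inv_sq_le2 (n : nat) : \sum_(1 <= m < n.+1) (/ INR m ^ 2) <= 2.
Proof.
case: n => [|n]; first by rewrite big_geq //; lra.
rewrite big_ltn // ; have := @sum_inv_sq 1 n.+1 isT isT.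
have := Rinv_0_lt_compat (INR n.+1); have := INR_ge1 (isT : (0 < n.+1)%N).
rewrite -[INR 1]/1 Rinv_1 pow1 Rinv_1 -[Monoid.ComLaw.sort _]/Rplus; lra.
Qed.

(** Controls truncation of the totient series: a tail of size [1 / n] costs only [O(n ^ 4)] against
    the factor [n ^ 5]. *)
Lemma sum_totient_cube_tail (n p : nat) : (0 < n)%N -> (n <= p)%N ->
  \sum_(1 <= m < p.+1) (INR (totient m) * / INR m ^ 3) <=
  \sum_(1 <= m < n.+1) (INR (totient m) * / INR m ^ 3) + / INR n.
Proof.
move=> n0 np; rewrite (big_cat_nat (n := n.+1)) //=.
apply: Rplus_le_compat_l.
have p0 : 0 < / INR p by apply/Rinv_0_lt_compat/lt_0_INR/leP; lia.
apply: (Rle_trans _ (\sum_(n.+1 <= m < p.+1) (/ INR m ^ 2))).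
  apply: Rsum_le => m; rewrite mem_index_iota => mn _; apply: totient_cube_le; lia.
have := sum_inv_sq n0 np; lra.
Qed.

Lemma sum_totient_cube_le2 (n : nat) :
  \sum_(1 <= m < n.+1) (INR (totient m) * / INR m ^ 3) <= 2.
Proof.
apply: Rle_trans (sum_inv_sq_le2 n); apply: Rsum_le => m; rewrite mem_index_iota => mn _.
by apply: totient_cube_le; lia.
Qed.

Lemma sum_inv_cube_le2 (n : nat) : \sum_(1 <= m < n.+1) (/ INR m ^ 3) <= 2.
Proof.
apply: Rle_trans (sum_inv_sq_le2 n); apply: Rsum_le => m; rewrite mem_index_iota => mn _.
have m0 : (0 < m)%N by lia.
have m1 := INR_ge1 m0.
by apply: Rinv_le_contravar; [apply: pow_lt; lra|apply: Rle_pow => //; apply/leP].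
Qed.

(** * The totient Dirichlet series at 3 and its value [zeta 2 / zeta 3] *)

Definition totient_zeta : R := Series (fun k => INR (totient (k + 1)) * / INR (k + 1) ^ 3).

Lemma sum_multiples (d X : nat) (F : nat -> R) : (0 < d)%N ->
  \sum_(1 <= m < X.+1 | (d %| m)%N) F m = \sum_(1 <= e < (X %/ d).+1) F (d * e)%N.
Proof.
move=> d0; elim: X => [|X IH]; first by rewrite div0n !big_geq.
rewrite big_mkcond big_nat_recr // -big_mkcond IH divnS //=.
case: (boolP (d %| X.+1)%N) => dX /=; last by rewrite add0n Rplus_0_r.
rewrite add1n [RHS]big_nat_recr //=; congr (_ + F _).
by move: (divnS X d0) (divnK dX); rewrite dX mulnC => ->.
Qed.

(** Write [1 / m ^ 2] as [m / m ^ 3], expand [m] as the sum of the totients of its divisors, and put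
    [m = d e]. The right side is the product of the two series restricted to [d e <= X]. *)
Lemma sum_inv_sq_totient (X : nat) :
  \sum_(1 <= m < X.+1) (/ INR m ^ 2) =
  \sum_(1 <= d < X.+1) (INR (totient d) * / INR d ^ 3 *
     \sum_(1 <= e < (X %/ d).+1) (/ INR e ^ 3)).
Proof.
transitivity (\sum_(1 <= m < X.+1) \sum_(1 <= d < X.+1 | (d %| m)%N)
    (INR (totient d) * / INR m ^ 3)).
  rewrite big_nat [RHS]big_nat; apply: eq_bigr => m /andP[m0 mX].
  have m1 := INR_ge1 m0.
  rewrite -big_distrl /= -INR_sum.
  have -> : (\sum_(1 <= d < X.+1 | d %| m) totient d)%N = m.
    rewrite -[RHS]sum_totient_dvd.
    rewrite -(big_mkord (fun d => d %| m)%N (fun d => totient d)).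
    rewrite [RHS]big_mkcond [RHS]big_ltn // dvd0n.
    have -> : (m == 0)%N = false by lia.
    rewrite /= add0n -big_mkcond [LHS](big_cat_nat (n := m.+1)) //=.
    rewrite [X in (_ + X)%N]big_nat_cond [X in (_ + X)%N]big1 ?addn0 // => d /andP[dm ddm].
    by have := dvdn_leq m0 ddm; lia.
  by rewrite /=; field; lra.
under eq_bigr do rewrite big_mkcond.
rewrite exchange_big /= big_nat [RHS]big_nat; apply: eq_bigr => d /andP[d0 dX].
rewrite -big_mkcond sum_multiples // big_distrr /= big_nat [RHS]big_nat.
apply: eq_bigr => e /andP[e0 _]; have d1 := INR_ge1 d0; have e1 := INR_ge1 e0.
by rewrite mult_INR; field; lra.
Qed.

Lemma totient_zetaE : totient_zeta * zeta 3 = zeta 2.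
Proof.
have B2 := bounded_series (inv_pow_ge0 2) sum_inv_sq_le2.
have B3 := bounded_series (inv_pow_ge0 3) sum_inv_cube_le2.
have BT := bounded_series totient_cube_ge0 sum_totient_cube_le2.
have U2 n := bounded_series_ge n (inv_pow_ge0 2) sum_inv_sq_le2.
have U3 n := bounded_series_ge n (inv_pow_ge0 3) sum_inv_cube_le2.
have UT n := bounded_series_ge n totient_cube_ge0 sum_totient_cube_le2.
have z3 : 0 <= zeta 3 by have := U3 0%N; rewrite big_geq.
apply: Rle_antisym.
  have L := is_lim_seq_mult' _ _ _ _ BT B3.
  apply: (is_lim_seq_le _ _ _ _ _ L (is_lim_seq_const (zeta 2))) => Y.
  (* The cutoff [Y * Y] is chosen so that the region [d e <= Y * Y] contains the box [d, e <= Y];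
     the remaining terms are nonnegative. *)
  apply: Rle_trans (U2 (Y * Y)%N); rewrite sum_inv_sq_totient.
  rewrite [X in _ <= X](big_cat_nat (n := Y.+1)) //=; last by nia.
  rewrite -[X in X <= _]Rplus_0_r; apply: Rplus_le_compat.
    rewrite big_distrl /=; apply: Rsum_le => d; rewrite mem_index_iota => /andP[d0 dY] _.
    apply: Rmult_le_compat_l (totient_cube_ge0 d0) _.
    have YY : (Y <= Y * Y %/ d)%N by rewrite leq_divRL //; nia.
    rewrite [X in _ <= X](big_cat_nat (n := Y.+1)) //=.
    rewrite -[X in X <= _]Rplus_0_r; apply: Rplus_le_compat_l.
    by apply: Rsum_ge0 => e; rewrite mem_index_iota => e0 _; apply: (inv_pow_ge0 3); lia.
  apply: Rsum_ge0 => d; rewrite mem_index_iota => dY _.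
  apply: Rmult_le_pos; first by apply: totient_cube_ge0; lia.
  by apply: Rsum_ge0 => e; rewrite mem_index_iota => e0 _; apply: (inv_pow_ge0 3); lia.
(* Conversely, each inner sum is at most [zeta 3], and the outer partial sum is at most
   [totient_zeta]. *)
apply: (is_lim_seq_le _ _ _ _ _ B2 (is_lim_seq_const (totient_zeta * zeta 3))) => X.
rewrite sum_inv_sq_totient; apply: (Rle_trans _ _ _ _ (Rmult_le_compat_r _ _ _ z3 (UT X))).
rewrite big_distrl /=; apply: Rsum_le => d; rewrite mem_index_iota => /andP[d0 _] _.
by apply: Rmult_le_compat_l (totient_cube_ge0 d0) _; exact: U3.
Qed.

Lemma KconstE : Kconst = 10 / 3 * totient_zeta.
Proof.
have z3 : 1 <= zeta 3.
  have := bounded_series_ge 1 (inv_pow_ge0 3) sum_inv_cube_le2.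
  by rewrite big_nat1 pow1 Rinv_1.
by rewrite /Kconst -totient_zetaE; field; lra.
Qed.

(** * Summation over all ratios *)

Section Asymptotics.
Variable N : nat.
Hypothesis N1 : (1 < N)%N.
Local Notation n := (2 * N + 1)%N.

Definition pair_count (k l : nat) : nat :=
  ((1 + 2 * (N %/ maxn k l)) ^ 2 *
   (n ^ 2 + 2 * \sum_(1 <= t < n) (n - k * t) * (n - l * t)))%N.

Lemma pair_count_sym (k l : nat) : pair_count k l = pair_count l k.
Proof.
rewrite /pair_count maxnC; congr (_ * (_ + 2 * _))%N.
by apply: eq_bigr => t _; rewrite mulnC.
Qed.

Lemma INR_Cfrak2 : INR (Cfrak 2 N) = 2 * INR n ^ 5 - INR n ^ 2 +
  2 * \sum_(1 <= k < n) \sum_(1 <= l < n | coprime k l) (INR (pair_count k l) - INR n ^ 2).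
Proof.
have powE k : INR (n ^ k)%N = INR n ^ k.
  by elim: k => [|k IH] //; rewrite expnS mult_INR IH.
under eq_bigr do rewrite Rsum_sub.
rewrite Rsum_sub.
have := congr1 INR (Cfrak2E N).
rewrite (plus_INR (_ + n ^ 2)%N) (plus_INR (Cfrak 2 N)) (plus_INR (2 * n ^ 5)%N).
rewrite !(mult_INR 2 (\sum_(_ <= _ < _) _)) (mult_INR 2 (n ^ 5)) !powE !INR_sum.
under eq_bigr do rewrite INR_sum.
under [X in _ = _ + _ * X]eq_bigr do rewrite INR_sum.
rewrite -[INR 2]/2 => H.
set A := (X in 2 * (X - _)); set B := (X in 2 * (_ - X)).
suff : INR (Cfrak 2 N) + INR n ^ 2 + 2 * B = 2 * INR n ^ 5 + 2 * A by lra.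
rewrite /A /B -H; congr (_ + 2 * _).
by apply: eq_bigr => k _; apply: eq_bigr => l _; rewrite powE.
Qed.

Definition pair_main (m j : nat) : R := INR n ^ 5 / INR m ^ 3 * (1 - INR j / (3 * INR m)).

Lemma sum_pair_main :
  \sum_(1 <= m < n) \sum_(1 <= j < m.+1 | coprime m j) pair_main m j =
  INR n ^ 5 * (5 / 6 * \sum_(1 <= m < n) (INR (totient m) * / INR m ^ 3) - 1 / 6).
Proof.
transitivity (\sum_(1 <= m < n) (INR n ^ 5 * (5 / 6 * (INR (totient m) * / INR m ^ 3)
    - (if m == 1%N then 1 / 6 else 0)))).
  rewrite big_nat [RHS]big_nat; apply: eq_bigr => m /andP[m0 _].
  have m1 := INR_ge1 m0.
  rewrite -big_distrr /= sum_coprime_weight //; case: eqP => [->|_] /=; field; lra.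
rewrite -big_distrr /= Rsum_sub -big_distrr /=; congr (_ * (_ - _)).
rewrite big_ltn /=; last by lia.
rewrite big_nat big1 => [|m /andP[m1 _]]; first by rewrite /=; lra.
by case: eqP => // E; lia.
Qed.

Lemma pair_count_estimate (m j : nat) : (0 < j)%N -> (j <= m)%N -> (m < n)%N ->
  Rabs (INR (pair_count m j) - INR n ^ 2 - pair_main m j) <= 21 * INR n ^ 4 / INR m ^ 2.
Proof.
move=> j0 jm mn; rewrite /pair_count (maxn_idPl jm); exact: ratio_count_estimate.
Qed.

(** At most [m] values of [j] each contribute an error [O(n ^ 4 / m ^ 2)], which leaves a harmonic
    sum and hence the logarithm. *)
Lemma sum_pair_error :
  Rabs (\sum_(1 <= m < n) \sum_(1 <= j < m.+1 | coprime m j)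
          (INR (pair_count m j) - INR n ^ 2 - pair_main m j))
  <= 21 * INR n ^ 4 * \sum_(1 <= m < n) (/ INR m).
Proof.
apply: Rle_trans (Rsum_abs _ _ _) _; rewrite big_distrr /=.
apply: Rsum_le => m; rewrite mem_index_iota => /andP[m0 mn] _.
have m1 := INR_ge1 m0.
apply: Rle_trans (Rsum_abs _ _ _) _.
have E0 : 0 <= 21 * INR n ^ 4 / INR m ^ 2.
  by apply: Rle_trans (Rabs_pos _) (@pair_count_estimate m 1 _ _ _).
apply: (Rle_trans _ (\sum_(1 <= j < m.+1) (21 * INR n ^ 4 / INR m ^ 2))).
  rewrite big_mkcond; apply: Rsum_le => j; rewrite mem_index_iota => /andP[j0 jm] _.
  by case: ifP => _ //; apply: pair_count_estimate.
by rewrite Rsum_const_nat; apply: Req_le; field; lra.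
Qed.

(** The coefficient [10/3] is [4 * 5/6]. The remaining multiples of [n ^ 5] cancel: 2 from the
    scalar pairs, [-4/6] from the exceptional weight at [m = 1], and [-2 * 2/3] from the ratio
    [(1, 1)]. In the error, [84 = 4 * 21] and [43 = 1 + 2 * 21]. *)
Lemma Cfrak2_partial :
  Rabs (INR (Cfrak 2 N) -
        10 / 3 * (\sum_(1 <= m < n) (INR (totient m) * / INR m ^ 3)) * INR n ^ 5)
  <= INR n ^ 4 * (43 + 84 * \sum_(1 <= m < n) (/ INR m)).
Proof.
rewrite INR_Cfrak2 sum_coprime_pairs_max; [|lia|by move=> k l; rewrite pair_count_sym].
have err : Rabs (
    \sum_(1 <= m < n) \sum_(1 <= j < m.+1 | coprime m j) (INR (pair_count m j) - INR n ^ 2) -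
    \sum_(1 <= m < n) \sum_(1 <= j < m.+1 | coprime m j) pair_main m j)
    <= 21 * INR n ^ 4 * \sum_(1 <= m < n) (/ INR m).
  by rewrite -Rsum_sub; under eq_bigr do rewrite -Rsum_sub; exact: sum_pair_error.
move: err; rewrite sum_pair_main.
have := @pair_count_estimate 1 1 isT isT; have -> : (1 < n)%N by lia.
move=> /(_ isT).
have -> : pair_main 1 1 = 2 / 3 * INR n ^ 5 by rewrite /pair_main /=; field.
have -> : 21 * INR n ^ 4 / INR 1 ^ 2 = 21 * INR n ^ 4 by rewrite /=; field.
have n1 : 1 <= INR n by apply: INR_ge1; lia.
have n24 : 0 <= INR n ^ 2 <= INR n ^ 4.
  by split; [apply: pow_le; lra|apply: Rle_pow; [lra|apply/leP]].
set g11 := INR (pair_count 1 1) - _.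
set A := (X in 5 / 6 * X); set H := \big[_/_]_(_ <= _ < _) / _.
move=> /Rabs_le_between h1 /Rabs_le_between h2; apply: Rabs_le; rewrite -/A; lra.
Qed.

End Asymptotics.

(** * Passage to the full series, from [2 * N + 1] to [2 * N], and explicit constants *)

Lemma Cfrak2_asymptotics (N : nat) : (1 < N)%N ->
  Rabs (INR (Cfrak 2 N) - Kconst * INR (2 * N) ^ 5)
  <= 40662 * INR N ^ 4 * ln (INR N).
Proof.
move=> N1; have := Cfrak2_partial N1; rewrite addn1.
have M0 : (0 < 2 * N)%N by lia.
have := harmonic_le M0.
have UT := bounded_series_ge (2 * N) totient_cube_ge0 sum_totient_cube_le2.
have LT := bounded_series_le totient_cube_ge0 sum_totient_cube_le2
  (fun p => @sum_totient_cube_tail (2 * N) p M0).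
have T2 := bounded_series_le totient_cube_ge0 sum_totient_cube_le2
  (fun p (_ : (0 <= p)%N) => sum_totient_cube_le2 p).
rewrite -/totient_zeta in UT LT T2.
have T0 : 0 <= totient_zeta.
  by have := bounded_series_ge 0 totient_cube_ge0 sum_totient_cube_le2; rewrite big_geq.
rewrite KconstE S_INR; move: totient_zeta UT LT T2 T0 => z UT LT T2 T0.
set A := \sum_(1 <= m < (2 * N).+1) (INR (totient m) * / INR m ^ 3) in UT LT *.
set H := \sum_(1 <= m < (2 * N).+1) (/ INR m).
have x2 : 2 <= INR N by apply: (le_INR 2); apply/leP.
have -> : INR (2 * N)%N = 2 * INR N by rewrite (mult_INR 2).
rewrite (mult_INR 2) -[INR 2]/2 in LT.
clearbody A H; move: (INR N) (INR (Cfrak 2 N)) x2 LT => x c x2 LT hH main.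
have l2 : / 2 <= ln 2 by have := ln_lt_2; lra.
have lx : ln 2 <= ln x by apply: ln_le; lra.
rewrite ln_mult in hH; [|lra|lra].
pose y := 2 * x + 1.
have A0 : 0 <= z - A <= / (2 * x) by lra.
have y0 : 1 <= y by rewrite /y; lra.
have y4 : 0 <= y ^ 4 by apply: pow_le; lra.
have y4x : y ^ 4 <= 81 * x ^ 4.
  have -> : 81 * x ^ 4 = (3 * x) ^ 4 by ring.
  by apply: pow_incr; rewrite /y; lra.
(* From [1 <= 2 * ln x] and [ln 2 <= ln x], the bound [43 + 84 * (1 + ln 2 + ln x)] is at most
   [(2 * 127 + 2 * 84) * ln x]. *)
have main1 : Rabs (c - 10 / 3 * A * y ^ 5) <= y ^ 4 * (422 * ln x).
  by apply: Rle_trans main _; apply: Rmult_le_compat_l => //; lra.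
have diff5 : 0 <= y ^ 5 - (2 * x) ^ 5 <= 5 * y ^ 4.
  have -> : 2 * x = y - 1 by rewrite /y; ring.
  have {}y0 : 5 <= y by rewrite /y; lra.
  clear -y0; have mono : (y - 1) ^ 5 <= y ^ 5 by apply: pow_incr; lra.
  split; first lra.
  have -> : y ^ 5 - (y - 1) ^ 5 = 5 * y ^ 4 - y ^ 2 * 10 * (y - 1) - (5 * y - 1) by ring.
  have : 0 <= y ^ 2 * 10 * (y - 1) by apply: Rmult_le_pos; nra.
  lra.
have tail : 0 <= (z - A) * y ^ 5 <= 2 * y ^ 4.
  have yx : / (2 * x) * y <= 2.
    apply: (Rmult_le_reg_l (2 * x)); first lra.
    by rewrite -Rmult_assoc Rinv_r ?Rmult_1_l /y; lra.
  have -> : (z - A) * y ^ 5 = (z - A) * y * y ^ 4 by ring.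
  have : 0 <= (z - A) * y <= 2 by split; [apply: Rmult_le_pos; lra|nra].
  by move=> [p1 p2]; split; [exact: Rmult_le_pos|exact: Rmult_le_compat_r].
have head : 0 <= z * (y ^ 5 - (2 * x) ^ 5) <= 10 * y ^ 4.
  by split; [apply: Rmult_le_pos; lra|nra].
(* [tail] and [head] add [10/3 * (2 + 10) = 40] times [y ^ 4], and [40 <= 80 * ln x] raises 422 to
   502. *)
have fin : Rabs (c - 10 / 3 * z * (2 * x) ^ 5) <= y ^ 4 * (502 * ln x).
  have y4l : y ^ 4 * (422 * ln x) + 40 * y ^ 4 <= y ^ 4 * (502 * ln x).
    have -> : y ^ 4 * (422 * ln x) + 40 * y ^ 4 = y ^ 4 * (422 * ln x + 40) by ring.
    by apply: Rmult_le_compat_l => //; lra.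
  apply: Rle_trans y4l; move/Rabs_le_between: main1 => main1; apply: Rabs_le; lra.
apply: Rle_trans fin _.
(* The factor 81 comes from [y <= 3 * x], and [40662 = 81 * 502]. *)
have -> : 40662 * x ^ 4 * ln x = 81 * x ^ 4 * (502 * ln x) by ring.
by apply: Rmult_le_compat_r => //; lra.
Qed.

End Analysis.

Theorem theorem1p2 :
  exists C : R, forall N : nat, (1 < N)%nat ->
    (Rabs (INR (Cfrak 2 N) - Kconst * (INR (2 * N)) ^ 5)
       <= C * (INR N) ^ 4 * ln (INR N))%R.
Proof.
exists 40662%R; intros N N1.
apply Analysis.Cfrak2_asymptotics.
now apply (Bool.reflect_iff _ _ ssrnat.ltP).
Qed.
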